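(* (i) For each $n=2,3,\ldots$, $p_n>q_n$. (ii) For $1\le n\le 8$, $r_n=a_n$, except that $r_7=4$ and $a_7=3$; for $n\ge 9$, $r_n>a_n$.
   Context: Fix an integer $n\ge1$. There are $2n$ applicants with absolute ranks $1,1,2,2,\ldots,n,n$ (1 is best, $n$ is worst), interviewed in a uniformly random order: $R_j$ denotes the absolute rank of the $j$-th applicant, $j=1,\ldots,2n$, and $P\bigl((R_1,\ldots,R_{2n})=\sigma\bigr)=2^n/(2n)!$ for every distinct arrangement $\sigma$ of the multiset $(1,1,2,2,\ldots,n,n)$. For $1\le j\le 2n$, $X_j$ is the number of distinct values in $\{R_i:\ R_i\le R_j,\ 1\le i\le j\}$ (the relative rank of the $j$-th applicant among the first $j$), and $D_j$ is the number of distinct values in $\{R_1,\ldots,R_j\}$. $\mathcal{F}_j$ is the $\sigma$-algebra generated by $(X_1,D_1),\ldots,(X_j,D_j)$, and $\mathcal{M}_n$ is the set of all stopping rules (stopping times) with values in $\{1,\ldots,2n\}$ adapted to $\{\mathcal{F}_j\}_{1\le j\le 2n}$. The maximum probability of selecting one of the two best applicants is $$p_n=\sup_{\tau\in\mathcal{M}_n}P(R_\tau=1).$$ For $1\le j\le n$ let $k_j=\min\{1\le i\le 2n:\ D_i=j\}$ be the time at which the $j$-th new rank value appears, and put $X'_j=X_{k_j}$ (relative rank of the $j$-th new number) and $R'_j=R_{k_j}$ (absolute rank of the $j$-th new number). Let $\mathcal{F}'_j$ be the $\sigma$-algebra generated by $X'_1,\ldots,X'_j$ and $\mathcal{M}'_n$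 the set of all stopping rules with values in $\{1,\ldots,n\}$ adapted to $\{\mathcal{F}'_j\}_{1\le j\le n}$. Define $$q_n=\sup_{\tau\in\mathcal{M}'_n}P(R'_\tau=1);$$ this is the optimal success probability in the classical secretary problem with $n$ applicants. The thresholds are $$a_n=\min\left\{i\ge1:\ \sum_{j=i+1}^{n}\frac{1}{j-1}\le 1\right\},\qquad r_n=\min\left\{i\ge 1:\ \frac{2n}{i}+\sum_{j=i+1}^{n}\frac{1}{j-1}\le 5\right\},$$ where empty sums are $0$. *)

(* Defs.v *)
From HB Require Import structures.
From mathcomp Require Import all_boot all_order all_algebra.
From mathcomp Require Import all_classical all_reals all_analysis.

Set Implicit Arguments.
Unset Strict Implicit.
Unset Printing Implicit Defensive.

Import Order.TTheory GRing.Theory Num.Theory.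
Local Open Scope classical_set_scope.
Local Open Scope ring_scope.

(** Number of arrangements of a multiset.  It is only used below to check that
    the weights 2^n / (2n)! add up to 1. *)

Lemma size_permutations_fact (T : eqType) (L s : seq T) :
  uniq L -> {subset s <= L} ->
  (size (permutations s) * \prod_(x <- L) (count_mem x s)`! = (size s)`!)%N.
Proof.
move=> uL; have [m] := ubnP (size s); elim: m s => // m IHm s sm sL.
have [->|s0] := eqVneq s [::]; first by rewrite big1.
rewrite (perm_size (permutationsE _)) ?lt0n ?size_eq0 // size_allpairs_dep.
rewrite sumnE big_map big_distrl /=.
transitivity (\sum_(x <- undup s) (count_mem x s * (size s).-1`!))%N.
  apply: eq_big_seq => x; rewrite mem_undup => xs.
  have xL := sL _ xs.
  have rs : size (rem x s) = (size s).-1 by rewrite size_rem.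
  have := IHm (rem x s); rewrite rs => <-; last 2 first.
  - by move: sm; case: (s) s0.
  - by move=> y /mem_rem /sL.
  rewrite mulnCA; congr (_ * _)%N.
  rewrite !(bigD1_seq x xL uL) /= mulnA; congr (_ * _)%N.
    have c0 : (0 < count_mem x s)%N by rewrite -has_count has_pred1.
    have -> : count_mem x (rem x s) = (count_mem x s).-1.
      by rewrite count_rem xs /= eqxx subn1.
    by rewrite -[LHS]/(_`!) -[in LHS](prednK c0) factS prednK.
  apply: eq_bigr => y yx; rewrite count_rem xs /= eq_sym (negPf yx).
  by rewrite subn0.
have sz : (\sum_(x <- undup s) count_mem x s = size s)%N.
  rewrite -[RHS](perm_size (perm_count_undup s)) size_flatten sumnE.
  rewrite /shape -map_comp big_map; apply: eq_bigr => x _ /=.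
  by rewrite size_nseq.
rewrite -big_distrl /= sz.
by rewrite -[in RHS](prednK (n := size s)) ?lt0n ?size_eq0// factS prednK
  ?lt0n ?size_eq0.
Qed.

(** The probability space: all distinct arrangements of 1, 1, 2, 2, ..., n, n,
    each of them with mass 2^n / (2n)!. *)

Definition ranks (n : nat) : seq nat :=
  flatten [seq [:: i; i] | i <- iota 1 n].

Definition arrangement (n : nat) : Type := seq_sub (permutations (ranks n)).

HB.instance Definition _ (n : nat) := Finite.on (arrangement n).

Definition Pr (R : realType) (n : nat) (E : pred (arrangement n)) : R :=
  \sum_(w : arrangement n | E w) ((2 ^ n)%:R / ((2 * n)`!)%:R).

Lemma card_arrangement (n : nat) :
  (#|{: arrangement n}| * 2 ^ n = (2 * n)`!)%N.
Proof.
have cm x : count_mem x (ranks n) = (2 * (x \in iota 1 n))%N.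
  rewrite /ranks count_flatten -map_comp sumnE big_map.
  rewrite -(count_uniq_mem x (iota_uniq 1 n)) -sum1_count big_distrr /=.
  rewrite [RHS]big_mkcond; apply: eq_bigr => i _ /=.
  by case: (i == x).
rewrite card_seq_sub ?permutations_uniq //.
rewrite -[in RHS](_ : size (ranks n) = (2 * n)%N); last first.
  rewrite /ranks size_flatten /shape -map_comp sumnE big_map /=.
  by rewrite big_const_seq count_predT size_iota iter_addn_0.
rewrite -(@size_permutations_fact _ (iota 1 n)) ?iota_uniq //; last first.
  move=> x; rewrite -has_pred1 has_count cm.
  by case: (x \in _).
congr (_ * _)%N; rewrite (eq_big_seq (fun=> 2%N)) => [|i /= ii]; last first.
  by rewrite cm ii.
by rewrite big_const_seq count_predT size_iota iter_muln_1.
Qed.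

Lemma Pr_total (R : realType) (n : nat) : Pr R (@predT (arrangement n)) = 1.
Proof.
by rewrite /Pr sumr_const -[LHS]mulr_natl mulrA -natrM card_arrangement divff.
Qed.

(** Times j are counted from 1. *)

Definition absrank (n j : nat) (w : arrangement n) : nat := nth 0%N (val w) j.-1.

Definition relrank (n j : nat) (w : arrangement n) : nat :=
  size (undup [seq absrank i w | i <- iota 1 j
                               & (absrank i w <= absrank j w)%N]).

Definition ndistinct (n j : nat) (w : arrangement n) : nat :=
  size (undup [seq absrank i w | i <- iota 1 j]).

(* The default value 2n of the minimum is never used for 1 <= j <= n. *)
Definition newtime (n j : nat) (w : arrangement n) : nat :=
  \big[minn/(2 * n)%N]_(1 <= i < (2 * n).+1 | ndistinct i w == j) i.

Definition new_relrank (n j : nat) (w : arrangement n) : nat := relrank (newtime j w) w.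

Definition new_absrank (n j : nat) (w : arrangement n) : nat := absrank (newtime j w) w.

(** The sigma-algebra generated by Y_1, ..., Y_j, for Y_i with values in a
    countable type, all of whose subsets are measurable. *)
Definition sigma_upto (T : Type) (U : countType) (Y : nat -> T -> U) (j : nat) :
    set (set T) :=
  <<s \bigcup_(i in [set i | (1 <= i <= j)%N])
        preimage_set_system [set: T] (Y i) [set: set U] >>.

Definition stopping_rule (T : Type) (U : countType) (Y : nat -> T -> U)
    (N : nat) (tau : T -> nat) : Prop :=
  (forall w, 1 <= tau w <= N)%N /\
  (forall j, (1 <= j <= N)%N -> sigma_upto Y j [set w | tau w = j]).

Definition p_opt (R : realType) (n : nat) : R :=
  sup [set Pr R (fun w : arrangement n => absrank (tau w) w == 1%N)
      | tau in stopping_rule (fun j (w : arrangement n) =>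
                                (relrank j w, ndistinct j w)) (2 * n)].

Definition q_opt (R : realType) (n : nat) : R :=
  sup [set Pr R (fun w : arrangement n => new_absrank (tau w) w == 1%N)
      | tau in stopping_rule (@new_relrank n) n].

Definition harmonic_sum (n i : nat) : rat :=
  \sum_(i.+1 <= j < n.+1) 1 / (j%:R - 1).

Lemma a_thr_ex (n : nat) :
  exists i : nat, (1 <= i)%N && (harmonic_sum n i <= 1).
Proof. by exists n.+1; rewrite /harmonic_sum big_geq. Qed.

Definition a_thr (n : nat) : nat := ex_minn (a_thr_ex n).

Lemma r_thr_ex (n : nat) :
  exists i : nat,
    (1 <= i)%N && ((2 * n)%:R / i%:R + harmonic_sum n i <= 5).
Proof.
exists n.+1; rewrite /harmonic_sum big_geq //= addr0 ler_pdivrMr ?ltr0n //.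
by rewrite -natrM ler_nat leq_mul.
Qed.

Definition r_thr (n : nat) : nat := ex_minn (r_thr_ex n).

(* Main.v *)
(** Given a rule [tau] for the classical problem, stop at the [tau]-th new number
    if its relative rank is 1, and otherwise at the first time when all [n] values
    have been seen and the current relative rank is 1, so that the second copy of
    the best applicant is caught.  This succeeds whenever [tau] does, and also on the
    arrangement 1, ..., n, 1, ..., n unless [tau] is constantly 1.  Stopping at the
    first applicant has the same success probability as stopping at the last one,
    by reversal, and the latter rule is improved in the same way.  Probabilities are
    integer multiples of 2^n / (2n)!, so these strict gains survive the supremum.

    For the thresholds, let n >= 9 and write [h i] for the sum in [a_n]; the claim is
    that 2n/r + h r <= 5 implies h (r - 1) <= 1.  If n > 2r, this follows from
    h (r - 1) = h r + 1/(r - 1).  If n <= 2r, then r >= 5 and h (r - 1) is at most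
    1/(r - 1) + ... + 1/(2r - 1), which decreases in [r] and is below 1 at r = 5. *)

Require Import Defs.
From mathcomp Require Import all_boot all_order all_algebra.
From mathcomp Require Import all_classical all_reals all_analysis.
From mathcomp Require Import zify ring lra.

Set Implicit Arguments.
Unset Strict Implicit.
Unset Printing Implicit Defensive.

Import Order.TTheory GRing.Theory Num.Theory.
Local Open Scope ring_scope.

(** * Rules adapted to countable observations *)

Section Adapted.
Local Open Scope classical_set_scope.

Definition agree_upto (T : Type) (U : countType) (Y : nat -> T -> U) (j : nat)
    (w w' : T) : Prop :=
  forall i, (1 <= i <= j)%N -> Y i w = Y i w'.

(** The sets closed under agreement of the observations up to [j] form a sigma-algebra that contains
    the generators. *)
Lemma sigma_upto_agree (T : Type) (U : countType) (Y : nat -> T -> U) (j : nat)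
    (A : set T) (w w' : T) :
  sigma_upto Y j A -> agree_upto Y j w w' -> A w -> A w'.
Proof.
pose S := [set B : set T | forall v v', agree_upto Y j v v' -> B v -> B v'].
have agC v v' : agree_upto Y j v v' -> agree_upto Y j v' v.
  by move=> ag i /ag.
suff: sigma_upto Y j `<=` S by move=> /[apply] SA; exact: SA.
apply: smallest_sub; first split.
- by [].
- by move=> B SB v v' /agC ag [vT nB]; split=> // /(SB _ _ ag).
- by move=> F SF v v' ag [k _ Fv]; exists k => //; exact: SF Fv.
by move=> B [i /= ij [C _ <-]] v v' ag [_ /= Cv]; split=> //=; rewrite -ag.
Qed.

(** Each atom is the complement of a countable union of generators, and countability of [T] makes
    [A] a countable union of atoms. *)
Lemma agree_sigma_upto (T U : countType) (Y : nat -> T -> U) (j : nat)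
    (A : set T) :
  (forall w w', agree_upto Y j w w' -> A w -> A w') -> sigma_upto Y j A.
Proof.
move=> detA; pose atom (w : T) := [set w' | agree_upto Y j w w'].
have atomS w : sigma_upto Y j (atom w).
  have -> : atom w = [set: T] `\`
      \bigcup_i [set w' | (1 <= i <= j)%N /\ Y i w <> Y i w'].
    apply/seteqP; split=> w' /=.
      by move=> ag; split=> // -[i _ [/ag]].
    move=> [_ nU] i ij; apply: contrapT => neY; apply: nU.
    by exists i.
  apply: sigma_algebraCD; apply: sigma_algebra_bigcup => i.
  have [ij|nij] := boolP (1 <= i <= j)%N; last first.
    rewrite [X in <<s _ >> X](_ : _ = set0); first exact: sigma_algebra0.
    by apply/seteqP; split=> // w' [].
  apply: sub_sigma_algebra; exists i => //; exists [set~ Y i w] => //.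
  apply/seteqP; split=> w' /=; first by move=> [_ neY]; split=> // /esym.
  by move=> [_ neY]; split=> // /esym.
have -> : A = \bigcup_k [set w' | exists w,
    [/\ pickle_inv k = Some w, A w & agree_upto Y j w w']].
  apply/seteqP; split=> w' /=.
    by move=> Aw'; exists (pickle w') => //; exists w'; rewrite pickleK_inv.
  by move=> [k _ [w [_ Aw ag]]]; exact: detA Aw.
apply: sigma_algebra_bigcup => k.
case ek : (pickle_inv k) => [w|]; last first.
  rewrite [X in <<s _ >> X](_ : _ = set0); first exact: sigma_algebra0.
  by apply/seteqP; split=> // w' [? []].
have [Aw|nAw] := pselect (A w).
  rewrite [X in <<s _ >> X](_ : _ = atom w); first exact: atomS.
  apply/seteqP; split=> w' /=; first by move=> [_ [[<-]]].
  by move=> ag; exists w.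
rewrite [X in <<s _ >> X](_ : _ = set0); first exact: sigma_algebra0.
by apply/seteqP; split=> // w' [_ [[<-]]].
Qed.

(** The rule is the first entrance time into [S]. As [S N] holds everywhere, it is automatically
    observable at time [N]. *)
Lemma hitting_rule (T U : countType) (Y : nat -> T -> U) (N : nat)
    (S : nat -> pred T) :
  (1 <= N)%N -> (forall w, S N w) ->
  (forall j w w', (1 <= j < N)%N -> agree_upto Y j w w' -> S j w -> S j w') ->
  exists tau, [/\ stopping_rule Y N tau, forall w, S (tau w) w &
    forall w j, (1 <= j)%N -> S j w -> (tau w <= j)%N].
Proof.
move=> N1 SN detS.
have ex w : exists j, (1 <= j)%N && S j w by exists N; rewrite N1 SN.
exists (fun w => ex_minn (ex w)).
have min w j : (1 <= j)%N -> S j w -> (ex_minn (ex w) <= j)%N.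
  by move=> j1 Sj; case: ex_minnP => k _; apply; rewrite j1.
split=> [|w|//]; last by case: ex_minnP => k /andP[].
split=> [w|j /andP[j1 jN]].
  by rewrite min //; case: ex_minnP => k /andP[->].
have detS' i w w' : (1 <= i <= j)%N -> agree_upto Y j w w' -> S i w -> S i w'.
  move=> /andP[i1 ij] ag; have [->//|iN] := eqVneq i N.
  apply: detS; last by move=> l /andP[l1 li]; apply: ag; rewrite l1 (leq_trans li).
  by rewrite i1 ltn_neqAle iN (leq_trans ij).
apply: agree_sigma_upto => w w' ag /=.
have ag' : agree_upto Y j w' w by move=> i /ag.
case: ex_minnP => k /andP[k1 Sk] mink kj; rewrite {k}kj in k1 Sk mink.
case: ex_minnP => k /andP[k1' Sk'] mink'; apply/eqP; rewrite eqn_leq.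
have kj : (k <= j)%N by apply: mink'; rewrite k1 (detS' _ w) // k1 leqnn.
rewrite kj; apply: mink; rewrite k1' /=.
by apply: detS' ag' Sk'; rewrite k1' kj.
Qed.

End Adapted.

(** * Ranks in an arrangement *)

Section Ranks.
Variable n : nat.
Implicit Type w : arrangement n.

Lemma mem_ranks x : (x \in ranks n) = (1 <= x <= n)%N.
Proof.
apply/flatten_mapP/idP => [[i]|x1n].
  by rewrite mem_iota !inE orbb add1n ltnS => i1n /eqP ->.
by exists x; rewrite ?mem_iota ?add1n ?ltnS // inE eqxx.
Qed.

Lemma size_ranks : size (ranks n) = (2 * n)%N.
Proof.
rewrite /ranks size_flatten /shape -map_comp sumnE big_map /=.
by rewrite big_const_seq count_predT size_iota iter_addn_0.
Qed.

Lemma val_perm_ranks w : perm_eq (val w) (ranks n).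
Proof. by rewrite -mem_permutations; exact: (valP w). Qed.

Lemma size_arrangement w : size (val w) = (2 * n)%N.
Proof. by rewrite (perm_size (val_perm_ranks w)) size_ranks. Qed.

Lemma absrank_bounds j w : (1 <= j <= 2 * n)%N -> (1 <= absrank j w <= n)%N.
Proof.
move=> j1n; rewrite -mem_ranks -(perm_mem (val_perm_ranks w)).
by apply: mem_nth; rewrite size_arrangement; lia.
Qed.

Lemma mem_seen j w x :
  reflect (exists2 i, (1 <= i <= j)%N & x = absrank i w)
          (x \in [seq absrank i w | i <- iota 1 j]).
Proof.
apply: (iffP mapP) => -[i]; rewrite ?mem_iota => ij ->; exists i => //; last first.
  by rewrite mem_iota; lia.
Qed.

Lemma relrank1 j w : (1 <= j <= 2 * n)%N -> absrank j w = 1%N -> relrank j w = 1%N.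
Proof.
move=> jn Rj; rewrite /relrank Rj.
apply: (@perm_size _ _ [:: 1%N]); apply: uniq_perm; rewrite ?undup_uniq // => x.
rewrite mem_undup inE; apply/mapP/eqP => [[i]|->].
  rewrite mem_filter mem_iota => /andP[Ri ij] ->.
  have: (1 <= absrank i w <= n)%N by apply: absrank_bounds; lia.
  by lia.
by exists j; rewrite // mem_filter Rj mem_iota; lia.
Qed.

(** Otherwise 1 and [absrank j w] would be two distinct values counted by [relrank j w]. *)
Lemma relrank1_seen i j w : (1 <= i <= j)%N -> (j <= 2 * n)%N ->
  absrank i w = 1%N -> relrank j w = 1%N -> absrank j w = 1%N.
Proof.
move=> ij jn Ri Xj; apply/eqP/negPn/negP => Rj.
have Rj1 : (1 <= absrank j w <= n)%N by apply: absrank_bounds; lia.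
have sub : {subset [:: 1%N; absrank j w] <= undup
    [seq absrank i w | i <- iota 1 j & (absrank i w <= absrank j w)%N]}.
  move=> x; rewrite !inE mem_undup => /orP[]/eqP->; apply/mapP.
    by exists i; rewrite ?Ri // mem_filter mem_iota Ri; lia.
  by exists j; rewrite // mem_filter mem_iota leqnn; lia.
have /uniq_leq_size /(_ sub) : uniq [:: 1%N; absrank j w].
  by rewrite /= inE eq_sym Rj.
by move: Xj; rewrite /relrank => ->.
Qed.

(** By counting, [n] distinct values among 1, ..., n exhaust them all. *)
Lemma ndistinct_full_seen j w : (j <= 2 * n)%N -> (1 <= n)%N ->
  ndistinct j w = n -> exists2 i, (1 <= i <= j)%N & absrank i w = 1%N.
Proof.
move=> jn n1 Dj.
have sub : {subset undup [seq absrank i w | i <- iota 1 j] <= iota 1 n}.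
  move=> x; rewrite mem_undup => /mem_seen[i ij ->].
  have: (1 <= absrank i w <= n)%N by apply: absrank_bounds; lia.
  by rewrite mem_iota add1n ltnS.
have [|_ eqm] := uniq_min_size (undup_uniq _) sub.
  by rewrite size_iota -[X in (X <= _)%N]Dj.
have: 1%N \in iota 1 n by rewrite mem_iota; lia.
by rewrite -eqm mem_undup => /mem_seen[i ij Ri]; exists i.
Qed.

Lemma absrank1_full j w : (1 <= j <= 2 * n)%N -> ndistinct j w = n ->
  relrank j w = 1%N -> absrank j w = 1%N.
Proof.
move=> /andP[j1 jn] Dj Xj.
have [|i ij Ri] := ndistinct_full_seen jn _ Dj; first by lia.
exact: relrank1_seen Ri Xj.
Qed.

(** * Counts of distinct values and times of new values *)

Lemma ndistinct0 w : ndistinct 0 w = 0%N.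
Proof. by []. Qed.

Lemma ndistinctS j w : (ndistinct j.+1 w <= (ndistinct j w).+1)%N.
Proof.
rewrite /ndistinct -[in X in (X <= _)%N](addn1 j) iotaD add1n map_cat /= undup_cat /=.
by rewrite size_cat addn1 ltnS size_filter count_size.
Qed.

(** The count starts at 0 and grows by at most one per step, so it skips no value. *)
Lemma ndistinct_ivt j w m : (1 <= m <= ndistinct j w)%N ->
  exists2 k, (1 <= k <= j)%N & ndistinct k w = m.
Proof.
elim: j => [|j IHj]; first by rewrite ndistinct0; lia.
have [mj /andP[m1 mj1]|mj /andP[m1 _]] := ltnP (ndistinct j w) m.
  by exists j.+1; [lia|have := ndistinctS j w; lia].
have [|k kj km] := IHj; first by rewrite m1.
by exists k => //; lia.
Qed.

Lemma newtime_le w k m : (1 <= k <= 2 * n)%N -> ndistinct k w = m ->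
  (newtime m w <= k)%N.
Proof.
move=> kn Dk; rewrite /newtime.
have: k \in index_iota 1 (2 * n).+1 by rewrite mem_index_iota; lia.
elim: (index_iota _ _) => //= i s IHs; rewrite inE big_cons.
case: eqP => [<-|_ /= ks]; first by rewrite Dk eqxx geq_minl.
by case: ifP => _; rewrite ?(leq_trans (geq_minr _ _)) ?IHs.
Qed.

Lemma newtime_cases w m : newtime m w = (2 * n)%N \/
  (1 <= newtime m w <= 2 * n)%N /\ ndistinct (newtime m w) w = m.
Proof.
rewrite /newtime big_nat_cond.
apply: (big_ind (fun x => x = (2 * n)%N \/ (1 <= x <= 2 * n)%N /\ ndistinct x w = m))
  => [|x y Hx Hy|i]; first by left.
  by case: (leqP x y).
by move=> /andP[i1 /eqP Di]; right; split.
Qed.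

Lemma newtime_bounds w m : (1 <= n)%N -> (1 <= newtime m w <= 2 * n)%N.
Proof. by move=> n1; case: (newtime_cases w m) => [->|[]//]; lia. Qed.

(** If the minimum equals its default 2n, minimality forces [k] = 2n, so the count is still [m]
    there. *)
Lemma ndistinct_newtime w m k : (1 <= k <= 2 * n)%N -> ndistinct k w = m ->
  ndistinct (newtime m w) w = m.
Proof.
move=> kn Dk; case: (newtime_cases w m) => [nt|[]//].
by have := newtime_le kn Dk; rewrite nt => nk; rewrite (_ : 2 * n = k)%N //; lia.
Qed.

(** Both times are at most [j], where the counts agree, so each is a candidate in the minimum
    defining the other. *)
Lemma newtime_agree w w' j m : (j <= 2 * n)%N ->
  (forall i, (1 <= i <= j)%N -> ndistinct i w = ndistinct i w') ->
  (1 <= m <= ndistinct j w)%N -> newtime m w = newtime m w'.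
Proof.
move=> jn ag mj; have [k kj Dk] := ndistinct_ivt mj.
have kn : (1 <= k <= 2 * n)%N by lia.
have Dk' : ndistinct k w' = m by rewrite -ag.
have n1 : (1 <= n)%N by lia.
have := newtime_le kn Dk; have := newtime_le kn Dk'.
have := newtime_bounds w m n1; have := newtime_bounds w' m n1.
have := ndistinct_newtime kn Dk; have := ndistinct_newtime kn Dk'.
move=> D' D b' b l' l; apply/eqP; rewrite eqn_leq; apply/andP; split.
  by apply: newtime_le => //; rewrite ag //; lia.
by apply: newtime_le => //; rewrite -ag //; lia.
Qed.

Lemma newtime1 w : (1 <= n)%N -> newtime 1 w = 1%N.
Proof.
move=> n1; have := @newtime_le w 1 1; have := newtime_bounds w 1 n1.
by move=> b l; have := l _ erefl; lia.
Qed.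

(** * Reversal and the arrangement 1, ..., n, 1, ..., n *)

Definition reversal w : arrangement n.
Proof.
exists (rev (val w)).
by rewrite mem_permutations perm_rev val_perm_ranks.
Defined.

Lemma reversalK : involutive reversal.
Proof. by move=> w; apply: val_inj; rewrite /= revK. Qed.

Lemma absrank_reversal w : (1 <= n)%N ->
  absrank (2 * n) (reversal w) = absrank 1 w.
Proof.
move=> n1; rewrite /absrank /= nth_rev size_arrangement; last by lia.
by congr nth; lia.
Qed.

Lemma double_iota_perm : perm_eq (iota 1 n ++ iota 1 n) (ranks n).
Proof.
rewrite perm_sym /ranks; elim: (iota 1 n) => //= i s IHs.
by rewrite perm_cons perm_sym -[X in s ++ X]cat1s perm_catCA perm_cons perm_sym.
Qed.

(** The witness for the strict gains: the k-th new value is k, at time k, and the second 1 comes at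
    time n+1, as soon as all values have been seen. *)
Definition increasing_twice : arrangement n.
Proof.
exists (iota 1 n ++ iota 1 n).
by rewrite mem_permutations double_iota_perm.
Defined.

Lemma absrank_increasing_twice i : (1 <= i <= n)%N ->
  absrank i increasing_twice = i.
Proof.
move=> ij; rewrite /absrank /= nth_cat size_iota ifT; last by lia.
by rewrite nth_iota; lia.
Qed.

Lemma absrank_increasing_twiceD i : (1 <= i <= n)%N ->
  absrank (n + i) increasing_twice = i.
Proof.
move=> ij; rewrite /absrank /= nth_cat size_iota ifF; last by lia.
by rewrite nth_iota; lia.
Qed.

Lemma ndistinct_increasing_twice i : (i <= n)%N ->
  ndistinct i increasing_twice = i.
Proof.
move=> ij; rewrite /ndistinct.
rewrite (_ : map _ _ = iota 1 i) ?undup_id ?iota_uniq ?size_iota //.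
rewrite -[RHS]map_id; apply/eq_in_map => k; rewrite mem_iota => ki.
by apply: absrank_increasing_twice; lia.
Qed.

Lemma newtime_increasing_twice m : (1 <= m <= n)%N ->
  newtime m increasing_twice = m.
Proof.
move=> mn; have Dm : ndistinct m increasing_twice = m.
  by apply: ndistinct_increasing_twice; lia.
have m2 : (1 <= m <= 2 * n)%N by lia.
have le := newtime_le m2 Dm.
have := ndistinct_newtime m2 Dm.
by rewrite ndistinct_increasing_twice; lia.
Qed.

End Ranks.

(** * The improved stopping rules *)

Section Improvement.
Variables (R : realType) (n : nat).
Implicit Types (w : arrangement n) (E F : pred (arrangement n)).

Let unit_mass : R := (2 ^ n)%:R / ((2 * n)`!)%:R.

Lemma PrE E : Pr R E = #|E|%:R * unit_mass.
Proof. by rewrite /Pr sumr_const [RHS]mulr_natl. Qed.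

Lemma unit_mass_gt0 : 0 < unit_mass.
Proof. by rewrite divr_gt0 // ltr0n ?expn_gt0 ?fact_gt0. Qed.

(** The arrangement [w0] contributes a full atom, a gap that does not depend on the events. *)
Lemma Pr_subpred_lt E F w0 : subpred E F -> F w0 -> ~~ E w0 ->
  Pr R E + unit_mass <= Pr R F.
Proof.
move=> EF Fw0 nEw0; rewrite !PrE -[X in _ + X]mul1r -mulrDl natr1.
rewrite ler_pM2r ?unit_mass_gt0 // ler_nat; apply: proper_card.
by apply/properP; split; [apply/fintype.subsetP|exists w0].
Qed.

Lemma Pr_le1 E : Pr R E <= 1.
Proof.
rewrite -(Pr_total R n) !PrE ler_pM2r ?unit_mass_gt0 // ler_nat.
exact: max_card.
Qed.

Lemma Pr_absrank_last : (1 <= n)%N ->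
  Pr R (fun w => absrank (2 * n) w == 1%N) = Pr R (fun w => absrank 1 w == 1%N).
Proof.
move=> n1; rewrite /Pr (reindex_inj (inv_inj (@reversalK n))) /=.
by apply: eq_bigl => w; rewrite absrank_reversal.
Qed.

Definition success (tau : arrangement n -> nat) : pred (arrangement n) :=
  fun w => absrank (tau w) w == 1%N.

Notation XD := (fun j w => (relrank j w, ndistinct j w)).

(* Once D_j = n, relative and absolute ranks coincide, so stopping at X_j = 1
   is certain to succeed. *)
Definition surely_best (j : nat) w : bool :=
  (ndistinct j w == n) && (relrank j w == 1%N).

Lemma surely_best_success j w : (1 <= j <= 2 * n)%N -> surely_best j w ->
  absrank j w = 1%N.
Proof. by move=> jn /andP[/eqP Dj /eqP Xj]; exact: absrank1_full. Qed.

Lemma surely_best_increasing_twice : (1 <= n)%N ->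
  surely_best n.+1 (increasing_twice n).
Proof.
move=> n1; apply/andP; split; last first.
  apply/eqP; apply: relrank1; first by lia.
  by rewrite -addn1 absrank_increasing_twiceD.
rewrite /ndistinct -[X in _ == X](size_iota 1 n).
apply/eqP/perm_size; rewrite -[X in perm_eq _ X](undup_id (iota_uniq 1 n)).
apply: perm_undup => x; rewrite mem_iota.
apply/mem_seen/idP => [[i ij ->]|xn].
  have : (1 <= absrank i (increasing_twice n) <= n)%N by apply: absrank_bounds; lia.
  lia.
by exists x; [lia|rewrite absrank_increasing_twice //; lia].
Qed.

(** [B] is an additional reason to stop, and the last alternative is the forced stop at the end.
    Minimality later bounds the stopping time by known candidates. *)
Lemma surely_best_hitting (B : nat -> pred (arrangement n)) : (1 <= n)%N ->
  (forall j w w', (1 <= j < 2 * n)%N -> agree_upto XD j w w' -> B j w -> B j w') ->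
  exists tau, [/\ stopping_rule XD (2 * n) tau,
    forall w, [|| B (tau w) w, surely_best (tau w) w | tau w == (2 * n)%N] &
    forall w j, (1 <= j)%N -> [|| B j w, surely_best j w | j == (2 * n)%N] ->
      (tau w <= j)%N].
Proof.
move=> n1 detB.
apply: (@hitting_rule _ _ XD (2 * n)
  (fun j w => [|| B j w, surely_best j w | j == (2 * n)%N])) => [|w|]; first lia.
  by rewrite eqxx !orbT.
move=> j w w' jn ag; case/or3P => [Bj|sb|->]; last by rewrite !orbT.
  by rewrite (detB j w w').
have [eX eD] : (relrank j w, ndistinct j w) = (relrank j w', ndistinct j w').
  by apply: ag; rewrite leqnn andbT; case/andP: jn.
by rewrite /surely_best -eX -eD; move: sb; rewrite /surely_best => ->; rewrite orbT.
Qed.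

Lemma beat_stopping_at_first : (2 <= n)%N -> exists2 tau,
  stopping_rule XD (2 * n) tau &
  Pr R (fun w => absrank 1 w == 1%N) + unit_mass <= Pr R (success tau).
Proof.
move=> n2; have n1 : (1 <= n)%N by lia.
have [//|tau [stau Stau mintau]] := @surely_best_hitting (fun _ _ => false) n1.
exists tau => //; rewrite -Pr_absrank_last //.
have tn w := stau.1 w.
apply: (@Pr_subpred_lt _ _ (increasing_twice n)) => [w /eqP Rw||].
- have := Stau w; rewrite orFb => /orP[sb|/eqP tw]; rewrite /success.
    by rewrite surely_best_success.
  by rewrite tw Rw.
- have tw_le : (tau (increasing_twice n) <= n.+1)%N.
    by apply: mintau => //; rewrite surely_best_increasing_twice.
  have tn' := tn (increasing_twice n).
  (* The forced stop is excluded because n+1 < 2n for n >= 2. *)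
  have := Stau (increasing_twice n); rewrite orFb => /orP[sb|/eqP tw]; last by lia.
  by rewrite /success surely_best_success.
rewrite (_ : 2 * n = n + n)%N; last lia.
rewrite absrank_increasing_twiceD; lia.
Qed.

(** The observations up to [j] determine the times and relative ranks of the first [tau w] new
    values, hence whether [tau] stops at the value arriving now. *)
Lemma newtime_success_agree (tau : arrangement n -> nat) (j : nat) w w' :
  stopping_rule (@new_relrank n) n tau -> (1 <= j < 2 * n)%N ->
  agree_upto XD j w w' ->
  j = newtime (tau w) w -> j = newtime (tau w') w'.
Proof.
move=> stau jn ag jE.
have agX i : (1 <= i <= j)%N -> relrank i w = relrank i w' by move=> /ag[].
have agD i : (1 <= i <= j)%N -> ndistinct i w = ndistinct i w' by move=> /ag[].
have tn := stau.1 w.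
(* Since [j] < 2n, the time is not the default of the minimum. *)
have Dj : ndistinct j w = tau w.
  by case: (newtime_cases w (tau w)) => [|[_]]; rewrite -jE //; lia.
have nt m : (1 <= m <= tau w)%N -> newtime m w = newtime m w'.
  by move=> mt; apply: (@newtime_agree n w w' j) => //; rewrite ?Dj //; lia.
suff -> : tau w' = tau w by rewrite -nt //; lia.
apply: (sigma_upto_agree (stau.2 _ tn) _ (erefl (tau w))) => m mt.
have [k kj Dk] := @ndistinct_ivt n j w m ltac:(by rewrite Dj).
have mj : (newtime m w <= j)%N.
  by apply: leq_trans (newtime_le _ Dk) _; lia.
rewrite /new_relrank -nt // agX //.
by have := @newtime_bounds n w m; lia.
Qed.

Lemma beat_new_number_rule (tau : arrangement n -> nat) : (2 <= n)%N ->
  stopping_rule (@new_relrank n) n tau -> tau (increasing_twice n) <> 1%N ->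
  exists2 tau', stopping_rule XD (2 * n) tau' &
    Pr R (fun w => new_absrank (tau w) w == 1%N) + unit_mass <= Pr R (success tau').
Proof.
move=> n2 stau tau1; have n1 : (1 <= n)%N by lia.
pose B j w := (j == newtime (tau w) w) && (relrank j w == 1%N).
have [j w w' jn ag /andP[/eqP jE /eqP Xj]|tau' [stau' Stau mintau]] :=
  @surely_best_hitting B n1.
  rewrite /B -(newtime_success_agree stau jn ag jE) eqxx.
  have [] : (relrank j w, ndistinct j w) = (relrank j w', ndistinct j w').
    by apply: ag; lia.
  by move=> <- _; rewrite Xj.
exists tau' => //; have tn w := stau'.1 w.
have ntn w := newtime_bounds w (tau w) n1.
apply: (@Pr_subpred_lt _ _ (increasing_twice n)) => [w /eqP Rw||].
(* When [tau] wins, [tau'] stops no later than the winning time: either exactly then, or at a surely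
   best applicant, or at 2n, which must then be the winning time. *)
- have Bw : B (newtime (tau w) w) w by rewrite /B eqxx (relrank1 _ Rw).
  have := mintau w _ (andP (ntn w)).1; rewrite Bw => /(_ isT) le.
  rewrite /success; case/or3P: (Stau w) => [/andP[/eqP-> _]|sb|/eqP tw].
  + exact/eqP.
  + by rewrite surely_best_success.
  + suff -> : tau' w = newtime (tau w) w by exact/eqP.
    by have := ntn w; lia.
(* Here [tau'] stops by time n+1 < 2n, hence with relative rank 1; as rank 1 was seen at time 1,
   this is a success. *)
- have := mintau (increasing_twice n) n.+1 isT.
  rewrite surely_best_increasing_twice // orbT => /(_ isT) tle.
  have tn' := tn (increasing_twice n).
  have Xt : relrank (tau' (increasing_twice n)) (increasing_twice n) = 1%N.
    by case/or3P: (Stau (increasing_twice n)) => [/andP[_ /eqP]|/andP[_ /eqP]|] //; lia.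
  apply/eqP; apply: (@relrank1_seen n 1) Xt; rewrite ?absrank_increasing_twice //; lia.
(* On this arrangement the value selected by [tau] is [tau] itself, which differs from 1. *)
rewrite /new_absrank.
have tn' := stau.1 (increasing_twice n).
by rewrite newtime_increasing_twice // absrank_increasing_twice //; apply/eqP.
Qed.

(** The first relative rank is always 1 and carries no information, so stopping there happens always
    or never. *)
Lemma new_stop1 (tau : arrangement n -> nat) w w' : (1 <= n)%N ->
  stopping_rule (@new_relrank n) n tau -> tau w = 1%N -> tau w' = 1%N.
Proof.
move=> n1 stau.
apply: (sigma_upto_agree (stau.2 1%N _)) => [//|i i1].
have -> : i = 1%N by lia.
rewrite /new_relrank !newtime1 // /relrank /= !leqnn //.
Qed.

Lemma q_opt_lt_p_opt : (2 <= n)%N -> q_opt R n < p_opt R n.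
Proof.
move=> n2; have n1 : (1 <= n)%N by lia.
suff le : q_opt R n <= p_opt R n - unit_mass.
  by apply: le_lt_trans le _; rewrite gtrBl unit_mass_gt0.
apply: ge_sup.
  (* The constant rule 1 shows that the supremum is over a nonempty set. *)
  exists (Pr R (fun w => new_absrank 1 w == 1%N)); exists (fun=> 1%N) => //.
  split=> // j jn; apply: agree_sigma_upto => w w' _ //.
have p_ub tau : stopping_rule XD (2 * n) tau -> Pr R (success tau) <= p_opt R n.
  move=> stau; apply: ub_le_sup; last by exists tau.
  by exists 1 => _ [t _ <-]; exact: Pr_le1.
move=> _ [tau stau <-]; rewrite lerBrDr.
suff [tau' stau' le] : exists2 tau', stopping_rule XD (2 * n) tau' &
    Pr R (fun w => new_absrank (tau w) w == 1%N) + unit_mass <= Pr R (success tau').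
  exact: le_trans le (p_ub _ stau').
have [t1|t1] := eqVneq (tau (increasing_twice n)) 1%N; last first.
  by apply: beat_new_number_rule => //; apply/eqP.
have [tau' stau' le] := beat_stopping_at_first n2; exists tau' => //.
rewrite (_ : Pr R _ = Pr R (fun w => absrank 1 w == 1%N)) //.
apply: eq_bigl => w.
by rewrite (new_stop1 w n1 stau t1) /new_absrank newtime1.
Qed.

End Improvement.

(** * The thresholds *)

Lemma harmonic_sumS (n i : nat) : (1 <= i < n)%N ->
  harmonic_sum n i = 1 / i%:R + harmonic_sum n i.+1.
Proof.
move=> iin; rewrite /harmonic_sum big_ltn; last by lia.
by rewrite -[i.+1%:R]natr1 addrK.
Qed.

Lemma harmonic_sum_geq (n i : nat) : (n <= i)%N -> harmonic_sum n i = 0.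
Proof. by move=> ni; rewrite /harmonic_sum big_geq. Qed.

Lemma harmonic_sum_recr (n i : nat) : (1 <= i <= n)%N ->
  harmonic_sum n.+1 i = harmonic_sum n i + 1 / n%:R.
Proof.
move=> iin; rewrite /harmonic_sum big_nat_recr /=; last by lia.
by rewrite -[n.+1%:R]natr1 addrK.
Qed.

Lemma harmonic_sum_le (n m i : nat) : (1 <= i)%N -> (n <= m)%N ->
  harmonic_sum n i <= harmonic_sum m i.
Proof.
move=> i1; elim: m => [|m IHm]; first by rewrite leqn0 => /eqP->.
rewrite leq_eqVlt => /orP[/eqP->//|]; rewrite ltnS => /IHm le.
have [im|mi] := leqP i m; last by rewrite (le_trans le)// !harmonic_sum_geq //; lia.
by rewrite harmonic_sum_recr ?i1 // (le_trans le) // lerDl divr_ge0 ?ler0n.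
Qed.

Ltac harmonic_eval :=
  repeat (rewrite harmonic_sumS; last by []);
  rewrite harmonic_sum_geq; last by [].

(** Passing from r to r+1 drops 1/(r-1) and adds the smaller amount 1/(2r) + 1/(2r+1). The base case
    is 1/4 + ... + 1/9 < 1. *)
Lemma harmonic_sum_double (r : nat) : (5 <= r)%N -> harmonic_sum (2 * r) r.-1 <= 1.
Proof.
elim: r => // r IHr; rewrite leq_eqVlt => /orP[/eqP<-|r5].
  by rewrite /=; harmonic_eval; lra.
have := IHr r5; rewrite harmonic_sumS; last by lia.
rewrite prednK; last by lia.
rewrite (_ : 2 * r.+1 = (2 * r).+2)%N; last by lia.
rewrite !harmonic_sum_recr; try lia.
move=> le1 /=.
have : 1 / (2 * r)%:R + 1 / (2 * r).+1%:R <= 1 / r.-1%:R :> rat.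
  case: r {IHr le1} r5 => // k k5 /=.
  have k0 : (0 : rat) < k%:R by rewrite ltr0n; lia.
  rewrite -[(2 * _).+1%:R]natr1 natrM -[k.+1%:R]natr1.
  set x : rat := k%:R in k0 *.
  rewrite -subr_ge0.
  have -> : 1 / x - (1 / (2 * (x + 1)) + 1 / (2 * (x + 1) + 1))
    = (5 * x + 6) / (x * (2 * (x + 1)) * (2 * (x + 1) + 1)).
    by field; lra.
  by rewrite divr_ge0 ?mulr_ge0; lra.
move: le1; move: (1 / r.-1%:R) (1 / (2 * r)%:R) (1 / (2 * r).+1%:R) => x y z.
lra.
Qed.

(** * Exact thresholds for small n *)

Lemma a_thr_eq (n i : nat) : (1 <= i)%N -> harmonic_sum n i <= 1 ->
  (forall k, (1 <= k < i)%N -> 1 < harmonic_sum n k) -> a_thr n = i.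
Proof.
move=> i1 hi hk; rewrite /a_thr; case: ex_minnP => m /andP[m1 hm] minm.
have mi : (m <= i)%N by apply: minm; rewrite i1.
apply/eqP; rewrite eqn_leq mi leqNgt; apply/negP => lt_mi.
have := hk m; rewrite m1 lt_mi ltNge hm; by move/(_ isT).
Qed.

Lemma r_thr_eq (n i : nat) : (1 <= i)%N ->
  (2 * n)%:R / i%:R + harmonic_sum n i <= 5 ->
  (forall k, (1 <= k < i)%N -> 5 < (2 * n)%:R / k%:R + harmonic_sum n k) ->
  r_thr n = i.
Proof.
move=> i1 hi hk; rewrite /r_thr; case: ex_minnP => m /andP[m1 hm] minm.
have mi : (m <= i)%N by apply: minm; rewrite i1.
apply/eqP; rewrite eqn_leq mi leqNgt; apply/negP => lt_mi.
have := hk m; rewrite m1 lt_mi ltNge hm; by move/(_ isT).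
Qed.

Ltac harmonic_lra := harmonic_eval; lra.

(** The thresholds certified below are at most 4, so only [k] = 1, 2, 3 can call for a
    computation. *)
Ltac harmonic_lra_below4 :=
  let k := fresh in let lt_k := fresh in
  move=> [|[|[|[|k]]]] lt_k;
  first [exact (False_ind _ (notF lt_k)) | harmonic_lra].

Lemma thr_small (n : nat) : (1 <= n <= 8)%N -> n <> 7%N -> r_thr n = a_thr n.
Proof.
(* A single index [i] certifies both minima at once. *)
have pick i : (1 <= i)%N ->
    (2 * n)%:R / i%:R + harmonic_sum n i <= 5 ->
    (forall k, (1 <= k < i)%N -> 5 < (2 * n)%:R / k%:R + harmonic_sum n k) ->
    harmonic_sum n i <= 1 ->
    (forall k, (1 <= k < i)%N -> 1 < harmonic_sum n k) -> r_thr n = a_thr n.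
  by move=> i1 h1 h2 h3 h4; rewrite (@r_thr_eq n i) // (@a_thr_eq n i).
case: n pick => [|[|[|[|[|[|[|[|[|n]]]]]]]]] pick // _ _.
- by apply: (pick 1%N isT); try harmonic_lra_below4; harmonic_lra.
- by apply: (pick 1%N isT); try harmonic_lra_below4; harmonic_lra.
- by apply: (pick 2%N isT); try harmonic_lra_below4; harmonic_lra.
- by apply: (pick 2%N isT); try harmonic_lra_below4; harmonic_lra.
- by apply: (pick 3%N isT); try harmonic_lra_below4; harmonic_lra.
- by apply: (pick 3%N isT); try harmonic_lra_below4; harmonic_lra.
- by apply: (pick 4%N isT); try harmonic_lra_below4; harmonic_lra.
Qed.

Lemma r_thr7 : r_thr 7 = 4%N.
Proof. by apply: (@r_thr_eq 7 4 isT); try harmonic_lra_below4; harmonic_lra. Qed.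

Lemma a_thr7 : a_thr 7 = 3%N.
Proof. by apply: (@a_thr_eq 7 3 isT); try harmonic_lra_below4; harmonic_lra. Qed.

(** * Comparison of the thresholds for n >= 9 *)

Lemma a_thr_lt_r_thr (n : nat) : (9 <= n)%N -> (a_thr n < r_thr n)%N.
Proof.
move=> n9; rewrite /r_thr; case: ex_minnP => r /andP[r1 hr] _.
have hge0 k : 0 <= harmonic_sum n k.
  have [nk|kn] := leqP n k; first by rewrite harmonic_sum_geq.
  rewrite /harmonic_sum big_nat_cond sumr_ge0 // => j /andP[/andP[kj _] _].
  by rewrite divr_ge0 // subr_ge0 ler1n; lia.
have n9' : 9 <= n%:R :> rat by rewrite ler_nat.
(* At r = 1 the left side is at least 2n >= 18. Thus r-1 >= 1 is an admissible candidate for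
   [a_thr n]. *)
have r2 : (2 <= r)%N.
  rewrite ltn_neqAle r1 andbT; apply/eqP => r_eq; move: hr.
  by rewrite -r_eq natrM divr1; have := hge0 1%N; lra.
suff hr1 : harmonic_sum n r.-1 <= 1.
  rewrite /a_thr; case: ex_minnP => a _ /(_ r.-1).
  by rewrite hr1; lia.
have [n2r|n2r] := leqP n (2 * r).
  apply: le_trans (@harmonic_sum_double r _); last by lia.
  by apply: harmonic_sum_le => //; lia.
rewrite harmonic_sumS; last by lia.
rewrite prednK //.
have r2' : 1 <= r.-1%:R :> rat by rewrite ler1n; lia.
suff : 4 + 1 / r.-1%:R <= (2 * n)%:R / r%:R :> rat by move: hr; lra.
have : (2 * r).+1%:R <= n%:R :> rat by rewrite ler_nat.
case: r {hr r1 r2 n2r} r2' => // k /=.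
rewrite -[(2 * _).+1%:R]natr1 !natrM -[k.+1%:R]natr1.
set x : rat := k%:R; set y : rat := n%:R => x1 xy.
(* With x = r-1 and y = n, the case n >= 2r+1 gives 2y >= 4x+6, while the left side is 4x+5+1/x with
   1/x <= 1. *)
have : (4 + 1 / x) * (x + 1) <= 2 * y.
  have -> : (4 + 1 / x) * (x + 1) = 4 * x + 5 + 1 / x by field; lra.
  have : 1 / x <= 1 by rewrite ler_pdivrMr ?mul1r //; lra.
  lra.
by rewrite -ler_pdivlMr //; lra.
Qed.

Theorem theorem3p1 (R : realType) :
  (forall n : nat, (2 <= n)%N -> q_opt R n < p_opt R n) /\
  ((forall n : nat, (1 <= n <= 8)%N -> n <> 7%N -> r_thr n = a_thr n) /\
   (r_thr 7 = 4%N /\ a_thr 7 = 3%N) /\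
   (forall n : nat, (9 <= n)%N -> (a_thr n < r_thr n)%N)).
Proof.
split; first exact: q_opt_lt_p_opt.
split; first exact: thr_small.
by split; [split; [exact: r_thr7|exact: a_thr7]|exact: a_thr_lt_r_thr].
Qed.
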